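(* For every finite game $\Gamma$ whose players have CPT preferences, there exists a profile of conjectures $\sigma^*=(\sigma^*_1,\dots,\sigma^*_n)\in\prod_i\Delta(A_i)$ such that $\sigma_i^*\in\overline{co}\big(\mathcal{B}_i(\mu_{-i}(\sigma^*_{-i}))\big)$ for all $i\in N$.
   Context: A game $\Gamma=(N,(A_i),(x_i))$: players $N=\{1,\dots,n\}$, finite action sets $A_i$, payoffs $x_i:A\to\mathbb{R}$, $A=\prod_iA_i$, $A_{-i}=\prod_{j\neq i}A_j$. Each player $i$ has CPT preferences with CPT value functional $V_i$ on finite lotteries (determined by a reference point, a continuous strictly increasing value function vanishing at the reference point, and continuous strictly increasing probability weighting functions $w_i^\pm:[0,1]\to[0,1]$ fixing $0$ and $1$, via the standard rank-dependent CPT formula). $B_i=\Delta(A_i)$ is the set of black-box strategies; for a belief $\mu_{-i}\in\Delta(A_{-i})$ and $b_i\in B_i$, $\mu(b_i,\mu_{-i})[a]=b_i[a_i]\mu_{-i}[a_{-i}]$, and $\mathcal{B}_i(\mu_{-i})=\arg\max_{b_i\in B_i}V_i(\{(\mu(b_i,\mu_{-i})[a],x_i(a))\}_{a\in A})$. For conjectures $\sigma_j\in\Delta(A_j)$, $\mu_{-i}(\sigma_{-i})[a_{-i}]=\prod_{j\ne i}\sigma_j[a_j]$. $\overline{co}$ denotes closed convex hull. *)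

(* Defs.v *)
From HB Require Import structures.
From mathcomp Require Import all_boot all_order all_algebra.
From mathcomp Require Import all_classical all_reals topology normedtype.
Set Implicit Arguments. Unset Strict Implicit. Unset Printing Implicit Defensive.
Import Order.TTheory GRing.Theory Num.Theory.
Import numFieldNormedType.Exports.
Local Open Scope ring_scope.
Local Open Scope classical_set_scope.

Record cpt (R : realType) := CPT {
  cpt_ref : R;
  cpt_v : R -> R;
  cpt_wp : R -> R;
  cpt_wm : R -> R;
  cpt_v_cont : continuous cpt_v;
  cpt_v_incr : forall s t, s < t -> cpt_v s < cpt_v t;
  cpt_v_ref : cpt_v cpt_ref = 0;
  cpt_wp_cont : {within `[0, 1], continuous cpt_wp};
  cpt_wm_cont : {within `[0, 1], continuous cpt_wm};
  cpt_wp_incr : forall s t, 0 <= s -> s < t -> t <= 1 -> cpt_wp s < cpt_wp t;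
  cpt_wm_incr : forall s t, 0 <= s -> s < t -> t <= 1 -> cpt_wm s < cpt_wm t;
  cpt_wp_range : forall s, 0 <= s <= 1 -> 0 <= cpt_wp s <= 1;
  cpt_wm_range : forall s, 0 <= s <= 1 -> 0 <= cpt_wm s <= 1;
  cpt_wp0 : cpt_wp 0 = 0;
  cpt_wp1 : cpt_wp 1 = 1;
  cpt_wm0 : cpt_wm 0 = 0;
  cpt_wm1 : cpt_wm 1 = 1
}.

(* A finite lottery: a list of (probability, outcome) pairs. *)
Definition lottery (R : realType) := seq (R * R).

(* Standard rank-dependent CPT value (Tversky-Kahneman 1992), summing over
   the distinct outcomes y of the lottery:
   gains  y > r : v(y) (w+(P[X >= y]) - w+(P[X > y]))
   losses y < r : v(y) (w-(P[X <= y]) - w-(P[X < y])). *)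
Definition cpt_value (R : realType) (P : cpt R) (L : lottery R) : R :=
  \sum_(y <- undup [seq pr.2 | pr <- L])
    (if cpt_ref P < y then
       cpt_v P y * (cpt_wp P (\sum_(pr <- L | y <= pr.2) pr.1)
                    - cpt_wp P (\sum_(pr <- L | y < pr.2) pr.1))
     else if y < cpt_ref P then
       cpt_v P y * (cpt_wm P (\sum_(pr <- L | pr.2 <= y) pr.1)
                    - cpt_wm P (\sum_(pr <- L | pr.2 < y) pr.1))
     else 0).

Definition is_dist (R : realType) (T : finType) (p : T -> R) : Prop :=
  (forall t, 0 <= p t) /\ \sum_(t : T) p t = 1.

Definition profile (n : nat) (A : 'I_n -> finType) := {dffun forall j : 'I_n, A j}.

Definition joint_prob (R : realType) (n : nat) (A : 'I_n -> finType)
  (i : 'I_n) (b : A i -> R) (sigma : forall j, A j -> R) (a : profile A) : R :=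
  b (a i) * \prod_(j < n | j != i) sigma j (a j).

Definition player_lottery (R : realType) (n : nat) (A : 'I_n -> finType)
  (xi : profile A -> R) (i : 'I_n) (b : A i -> R) (sigma : forall j, A j -> R)
  : lottery R :=
  [seq (joint_prob b sigma a, xi a) | a <- enum (profile A)].

Definition best_resp (R : realType) (n : nat) (A : 'I_n -> finType)
  (P : cpt R) (xi : profile A -> R) (i : 'I_n) (sigma : forall j, A j -> R)
  : set (A i -> R) :=
  [set b | is_dist b /\
     forall b' : A i -> R, is_dist b' ->
       cpt_value P (player_lottery xi b' sigma)
       <= cpt_value P (player_lottery xi b sigma)].

Definition convex_set (R : realType) (T : finType) (C : set (T -> R)) : Prop :=
  forall p q (t : R), C p -> C q -> 0 <= t <= 1 ->
    C (fun a => t * p a + (1 - t) * q a).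

Definition closed_set (R : realType) (T : finType) (C : set (T -> R)) : Prop :=
  forall p, (forall e : R, 0 < e -> exists2 q, C q & forall a, `|p a - q a| < e) ->
    C p.

Definition cl_co (R : realType) (T : finType) (S : set (T -> R)) : set (T -> R) :=
  [set p | forall C, convex_set C -> closed_set C -> S `<=` C -> C p].

Arguments best_resp {R n A} P xi i sigma.
Arguments player_lottery {R n A} xi i b sigma.
Arguments joint_prob {R n A} i b sigma a.

(* Main.v *)
(** The theorem is Kakutani's fixed point theorem for the best response
    correspondence, which has nonempty values (compactness) and closed graph (the
    CPT value is continuous in the strategies, because the outcomes of the lottery
    do not depend on them).

    On the Freudenthal triangulation of a grid, let 0/1 labels [l_i] take the value
    0 on the face [x_i = 0] and 1 on the opposite one. The sum over all simplices
    [v_0, ..., v_m] of the products of the increments [l_i(v_(i+1)) - l_i(v_i)] is,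
    modulo 2, a cup product of coboundaries, so that by Stokes it depends only on
    the boundary values of the [l_i]; for [l_i x = (x_i != 0)] it is 1. Hence
    some simplex has all increments nonzero, and a uniformly continuous vector field
    on the cube that points inwards has approximate zeros.

    A selection [b] of a correspondence, continuous or not, is smoothed with weights
    [f t] supported near the points [y t] of a finite net. An approximate zero of
    the field [sum_t f t x * (b (y t) - x)] is almost a convex combination of
    values of [b] at points near [x], and a limit of such points lies in the closed
    convex hull of the limit correspondence. The product of the simplices of mixed
    strategies is treated as a retract of a cube. *)
Require Import Defs.
From HB Require Import structures.
From mathcomp Require Import all_boot all_order all_algebra all_fingroup.
From mathcomp Require Import all_classical all_reals topology normedtype sequences.
From mathcomp Require Import lra zify.
Set Implicit Arguments. Unset Strict Implicit. Unset Printing Implicit Defensive.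
Import Order.TTheory GRing.Theory Num.Theory.
Import numFieldNormedType.Exports.
Local Open Scope ring_scope.
Local Open Scope classical_set_scope.

(** * The degree of a labelling of the grid *)

Lemma addF2 (x : 'F_2) : x + x = 0.
Proof. by apply/val_inj; case: x => [[|[|]]]. Qed.

Lemma addF2_eq0 (x y : 'F_2) : x + y = 0 -> x = y.
Proof. by move=> h; rewrite -[x]addr0 -(addF2 y) addrA h add0r. Qed.

(** Right multiplication by a transposition matches even permutations with odd ones, and matched
    terms cancel modulo 2. *)
Lemma sum_perm_tperm (m : nat) (s t : 'I_m) (H : {perm 'I_m} -> 'F_2) :
  s != t -> (forall r, H (r * tperm s t)%g = H r) -> \sum_r H r = 0.
Proof.
move=> st Ht; rewrite (bigID (@odd_perm 'I_m)) /=.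
rewrite [X in X + _](reindex_inj (mulIg (tperm s t))) /=.
rewrite [X in X + _](eq_big (fun r : {perm 'I_m} => ~~ odd_perm r) H) ?addF2 //.
by move=> r; rewrite odd_permM odd_tperm st addbT.
Qed.

Section Chains.
Variables (m k : nat).
Implicit Types (r : {perm 'I_m.+1}) (v : nat -> 'I_m.+1 -> nat).

(* The simplex of the Freudenthal triangulation with least vertex [p] that
   increments coordinate [a] at step [r a]. *)
Definition vtx (p : 'I_m.+1 -> nat) r (e : nat) : 'I_m.+1 -> nat :=
  fun a => (p a + (r a < e))%N.

(* The [f i] are differentiated along the edges of the path [v] in increasing order,
   the edge from [v d] to [v d.+1] being left out. *)
Definition cup (f : 'I_m -> ('I_m.+1 -> nat) -> 'F_2) (g : ('I_m.+1 -> nat) -> 'F_2)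
    (c d : nat) v : 'F_2 :=
  g (v c) * \prod_(i < m) (f i (v (bump d i).+1) + f i (v (bump d i))).

(* Moving the missing edge from [d] to [d.+1] adds a term that does not involve the
   vertex [d.+1]; the simplices obtained by exchanging the steps [d] and [d.+1]
   differ at this vertex only, so these terms cancel in pairs. *)
Lemma sum_cup_step f g c d p : (d < m)%N -> c != d.+1 ->
  \sum_r cup f g c d.+1 (vtx p r) = \sum_r cup f g c d (vtx p r).
Proof.
move=> dm cd; apply: addF2_eq0; rewrite -big_split /=.
have dm1 : (d < m.+1)%N by lia.
have dm2 : (d.+1 < m.+1)%N by lia.
apply: (@sum_perm_tperm _ (Ordinal dm1) (Ordinal dm2)) => [|r].
  by apply/eqP => -[]; lia.
have vE e : e != d.+1 -> 
    vtx p (r * tperm (Ordinal dm1) (Ordinal dm2))%g e = vtx p r e.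
  move=> ed; apply/funext => a; rewrite /vtx permM; congr (_ + nat_of_bool _)%N.
  by case: tpermP => [->|->|//] /=; lia.
pose dd := Ordinal dm.
have cupE r' : cup f g c d.+1 (vtx p r') + cup f g c d (vtx p r') =
    g (vtx p r' c) * ((f dd (vtx p r' d.+2) + f dd (vtx p r' d)) *
    \prod_(i < m | i != dd) (f i (vtx p r' (bump d i).+1) + f i (vtx p r' (bump d i)))).
  rewrite /cup -mulrDr (bigD1 dd) //= [in X in _ + X](bigD1 dd) //=.
  have -> : bump d.+1 d = d by rewrite /bump; lia.
  have -> : bump d d = d.+1 by rewrite /bump; lia.
  rewrite (eq_bigr (fun i => f i (vtx p r' (bump d i).+1) + f i (vtx p r' (bump d i)))).
    rewrite -mulrDl; congr (_ * (_ * _)).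
    by rewrite addrACA [X in _ + X]addrC addrACA addF2 add0r addrC.
  move=> i /eqP id.
  have /eqP nid : (i : nat) != d by apply/eqP => h; apply: id; apply/val_inj.
  suff -> : bump d.+1 i = bump d i by [].
  by rewrite /bump; lia.
rewrite !cupE !vE //; try lia.
congr (_ * (_ * _)); apply: eq_bigr => i /eqP id.
have /eqP nid : (i : nat) != d by apply/eqP => h; apply: id; apply/val_inj.
by rewrite !vE //; rewrite /bump; lia.
Qed.

(** The missing edge travels from [j] down to [0] without meeting the vertex [j.+1] that carries
    [g]; what is left is the facet opposite the first vertex. *)
Lemma sum_cup_down f g j p : (j <= m)%N ->
  \sum_r cup f g j.+1 j (vtx p r) = \sum_r cup f g j m (vtx p r \o succn).
Proof.
move=> jm.
have H d : (d <= j)%N ->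
    \sum_r cup f g j.+1 d (vtx p r) = \sum_r cup f g j.+1 0 (vtx p r).
  elim: d => [//|d IH] dj; rewrite sum_cup_step ?IH //; lia.
rewrite H //; apply: eq_bigr => r _; rewrite /cup; congr (_ * _).
apply: eq_bigr => i _; have -> : bump m i = i by rewrite /bump; have := ltn_ord i; lia.
by [].
Qed.

(** Here the missing edge travels up to [m], past vertices above [j] only, leaving the facet
    opposite the last vertex. *)
Lemma sum_cup_up f g j p : (j <= m)%N ->
  \sum_r cup f g j j (vtx p r) = \sum_r cup f g j m (vtx p r).
Proof.
move=> jm.
have H d : (j + d <= m)%N ->
    \sum_r cup f g j j (vtx p r) = \sum_r cup f g j (j + d) (vtx p r).
  elim: d => [|d IH] dj; first by rewrite addn0.
  rewrite IH; last lia.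
  by rewrite addnS sum_cup_step //; lia.
by rewrite (H (m - j)%N) subnKC.
Qed.

Definition face_const (a : 'I_m.+1) (h : ('I_m.+1 -> nat) -> 'F_2) :=
  forall x y, x a = y a -> x a = 0%N \/ x a = k.+1 -> h x = h y.

Definition face_zero (a : 'I_m.+1) (h : ('I_m.+1 -> nat) -> 'F_2) :=
  forall x, x a = 0%N \/ x a = k.+1 -> h x = 0.

(** If [a] is [j], the factor [g] vanishes on the face; otherwise [l a] is among the differentiated
    labels and has zero increment along an edge inside the face. *)
Lemma cup_face_eq0 (l : 'I_m.+1 -> ('I_m.+1 -> nat) -> 'F_2) g (j a : 'I_m.+1) c v :
  (forall i, face_const i (l i)) -> face_zero j g ->
  c = 0%N \/ c = k.+1 -> (forall e, (e <= m)%N -> v e a = c) ->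
  cup (l \o lift j) g j m v = 0.
Proof.
move=> hl hg hc hv; rewrite /cup.
have [aj|] := eqVneq a j.
  by rewrite hg ?mul0r // -aj hv //; have := ltn_ord a; lia.
rewrite eq_sym => /unlift_some[i ai _]; rewrite (bigD1 i) //=.
have -> : bump m i = i by rewrite /bump; have := ltn_ord i; lia.
have im := ltn_ord i.
rewrite -ai (hl a (v i.+1) (v i)) ?addF2 ?mul0r ?mulr0 //.
  by rewrite !hv //; lia.
by rewrite hv.
Qed.

Lemma eq_cup f g j v v' : (j <= m)%N ->
  (forall e, (e <= m)%N -> v e = v' e) -> cup f g j m v = cup f g j m v'.
Proof.
move=> jm hv; rewrite /cup hv //; congr (_ * _); apply: eq_bigr => i _.
have -> : bump m i = i by rewrite /bump; have := ltn_ord i; lia.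
by rewrite !hv //; have := ltn_ord i; lia.
Qed.

Notation cube := {ffun 'I_m.+1 -> 'I_k.+1}.
Notation pt p := (fun a => nat_of_ord ((p : cube) a)).

(* Dropping the first vertex of a simplex is dropping the last vertex of its
   neighbour; only the facets on the boundary of the grid are left unpaired. *)
Lemma sum_cup_shift (l : 'I_m.+1 -> ('I_m.+1 -> nat) -> 'F_2) g (j : 'I_m.+1) :
  (forall i, face_const i (l i)) -> face_zero j g ->
  \sum_(p : cube) \sum_r cup (l \o lift j) g j m (vtx (pt p) r \o succn) =
  \sum_(p : cube) \sum_r cup (l \o lift j) g j m (vtx (pt p) r).
Proof.
move=> hl hg; rewrite exchange_big [RHS]exchange_big /=.
(* The neighbour takes the same steps cyclically shifted: the coordinate [a] that [r] increments
   first comes last, and the base point moves by one along [a], wrapping around at [k]. *)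
pose cyc := perm (can_inj (@ord_predK m.+1)).
rewrite [RHS](reindex_inj (mulIg cyc)) /=; apply: eq_bigr => r _.
pose a := (r^-1)%g ord0.
have ra : r a = ord0 by rewrite permKV.
pose nx (p : cube) : cube := [ffun b => if b == a then ordS (p b) else p b].
have nx_inj : injective nx.
  move=> p q /ffunP h; apply/ffunP => b; have := h b; rewrite !ffunE.
  by case: eqP => // _ /(can_inj (@ordSK k.+1)).
rewrite [RHS](reindex_inj nx_inj) /=; apply: eq_bigr => p _.
have rc b : b != a -> ((r * cyc)%g b).+1 = r b :> nat.
  move=> ba; rewrite permM permE /=.
  have : r b != 0%N :> nat.
    apply: contraNneq ba => rb; apply/eqP/(@perm_inj _ r); rewrite ra; exact/val_inj.
  have := ltn_ord (r b); case: (r b : nat) => // q hq _.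
  by rewrite addSn /= modnDr modn_small //; lia.
have rca : (r * cyc)%g a = m :> nat.
  by rewrite permM permE ra /= modn_small.
have jm : (j <= m)%N by have := ltn_ord j; lia.
(* Without wrapping, both sides are the same facet. With wrapping, the facets lie in the faces
   [k.+1] and [0] of coordinate [a], and both terms vanish. *)
have [pk|pk] := ltnP (p a) k.
  apply: eq_cup => // e em; apply/funext => b; rewrite /vtx /= ffunE.
  have [->|ba] := eqVneq b a.
    by rewrite ra rca /= modn_small; lia.
  by rewrite -(rc b ba).
have pak : p a = k :> nat by have := ltn_ord (p a); lia.
rewrite (@cup_face_eq0 l g j a k.+1) ?(@cup_face_eq0 l g j a 0) //; first by left.
- by move=> e em; rewrite /vtx rca ffunE eqxx /= pak modnn; lia.
- by right.
- by move=> e em; rewrite /vtx /= ra pak addn1.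
Qed.

Definition grid_degree (l : 'I_m.+1 -> ('I_m.+1 -> nat) -> 'F_2) : 'F_2 :=
  \sum_(p : cube) \sum_r \prod_i (l i (vtx (pt p) r i.+1) + l i (vtx (pt p) r i)).

Lemma grid_degree_cup l (j : 'I_m.+1) : grid_degree l =
  \sum_(p : cube) (\sum_r cup (l \o lift j) (l j) j.+1 j (vtx (pt p) r) +
                   \sum_r cup (l \o lift j) (l j) j j (vtx (pt p) r)).
Proof.
apply: eq_bigr => p _; rewrite -big_split; apply: eq_bigr => r _ /=.
by rewrite (bigD1_ord j) //= mulrDl.
Qed.

(** The two degrees add up to an expression in [l j + l' j]. Pushing its missing edge to either end
    gives sums over first and last facets, which agree by [sum_cup_shift] and so cancel. *)
Lemma grid_degree_replace l l' (j : 'I_m.+1) :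
  (forall i, face_const i (l i)) -> (forall i, i != j -> l' i = l i) ->
  face_zero j (fun x => l j x + l' j x) -> grid_degree l = grid_degree l'.
Proof.
move=> hl hl' hj; apply: addF2_eq0; rewrite !(grid_degree_cup _ j) -big_split /=.
have -> : l' \o lift j = l \o lift j.
  by apply/funext => i /=; rewrite hl' // eq_sym neq_lift.
pose g x := l j x + l' j x.
have jm : (j <= m)%N by have := ltn_ord j; lia.
transitivity (\sum_(p : cube) (\sum_r cup (l \o lift j) g j.+1 j (vtx (pt p) r) +
                   \sum_r cup (l \o lift j) g j j (vtx (pt p) r))).
  apply: eq_bigr => p _; rewrite addrACA.
  by congr (_ + _); rewrite -big_split /=; apply: eq_bigr => r _; rewrite /cup -mulrDl.
rewrite big_split /= -(eq_bigr _ (fun p _ => esym (sum_cup_down _ _ _ jm))).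
rewrite sum_cup_shift //.
by rewrite [X in _ + X](eq_bigr _ (fun p _ => sum_cup_up _ _ _ jm)) addF2.
Qed.

(** Factor [i] is nonzero only if [p i = 0] and coordinate [i] is incremented at step [i]; only the
    simplex at the origin with the identity permutation counts. *)
Lemma grid_degree_coord :
  grid_degree (fun i x => (x i != 0%N)%:R) = 1.
Proof.
rewrite /grid_degree pair_big /= (bigD1 ([ffun=> ord0], 1%g)) //=.
rewrite [X in X + _]big1 ?[X in _ + X]big1 ?addr0 // => [[p r] /= h|i _].
  apply: contra_neq_eq h => /prodf_neq0 h.
  have hi i : p i = ord0 /\ r i = i.
    have := h i isT; rewrite /vtx /=.
    have -> : (r i < i.+1)%N = (r i <= i)%N by [].
    case: (p i) => -[|q] q0 /=; last by [].
    rewrite !add0n; case: ltngtP => [||/val_inj ->]; rewrite ?addF2 ?eqxx // => _.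
    by split => //; apply/val_inj.
  congr (_, _); first by apply/ffunP => i; rewrite ffunE; case: (hi i).
  by apply/permP => i; rewrite perm1; case: (hi i).
by rewrite /vtx ffunE perm1 /= !add0n ltnSn ltnn /= addr0.
Qed.

End Chains.

Lemma grid_miranda (m k : nat) (l : 'I_m -> ('I_m -> nat) -> bool) :
  (forall i x, x i = 0%N -> l i x = false) ->
  (forall i x, x i = k.+1 -> l i x = true) ->
  exists2 p : 'I_m -> nat, forall a, (p a <= k)%N &
    forall i, exists x y, [/\ forall a, (p a <= x a <= (p a).+1)%N,
      forall a, (p a <= y a <= (p a).+1)%N, l i x & ~~ l i y].
Proof.
case: m l => [|m] l l0 l1; first by exists (fun=> 0%N) => [|[]].
(* [L t] leads from [l] at [t = 0] to the coordinate labels at [t = m.+1], one label at a time, with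
   fixed values on the faces. *)
pose L t (i : 'I_m.+1) x : 'F_2 :=
  if (i < t)%N then (x i != 0%N)%:R else (l i x)%:R.
have L0 t i x : x i = 0%N -> L t i x = 0.
  by move=> x0; rewrite /L x0 l0 //; case: ifP.
have L1 t i x : x i = k.+1 -> L t i x = 1.
  by move=> x0; rewrite /L x0 l1 //; case: ifP.
have deg t : (t <= m.+1)%N -> grid_degree k (L 0%N) = grid_degree k (L t).
  elim: t => [//|t IH] tm; rewrite IH; last lia.
  apply: (@grid_degree_replace _ _ _ _ (Ordinal tm)).
  - move=> i x y xy [x0|x1]; first by rewrite !L0 // -xy.
    by rewrite !L1 // -xy.
  - move=> i it; apply/funext => x; rewrite /L ltnS leq_eqVlt.
    by case: eqP => // h; case/eqP: it; apply/val_inj.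
  - by move=> x [x0|x1]; rewrite ?(L0 _ _ _ x0) ?(L1 _ _ _ x1) addF2.
have : grid_degree k (L 0%N) != 0.
  rewrite (deg m.+1) // (_ : L m.+1 = fun i x => (x i != 0%N)%:R) ?grid_degree_coord //.
  by apply/funext => i; apply/funext => x; rewrite /L ltn_ord.
rewrite /grid_degree => /eqP D.
have [[p [r /prodf_neq0 h]]|N] := pselect (exists p : {ffun 'I_m.+1 -> 'I_k.+1},
    exists r, \prod_i (L 0%N i (vtx (fun a => p a : nat) r i.+1) +
              L 0%N i (vtx (fun a => p a : nat) r i)) != 0); last first.
  case: D; rewrite big1 // => p _; rewrite big1 // => r _.
  by apply/eqP/negP => /negP ?; apply: N; exists p, r.
exists (fun a => p a) => [a|i]; first by rewrite -ltnS.
have V e a : (p a <= vtx (fun a => p a : nat) r e a <= (p a).+1)%N.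
  by rewrite /vtx; case: (_ < _)%N; lia.
move: (h i isT); rewrite /L /=.
set x := vtx _ _ _; set y := vtx _ _ _.
case lx: (l i x); case ly: (l i y) => // _.
  by exists x, y; rewrite lx ly; split=> // a; apply: V.
by exists y, x; rewrite lx ly; split=> // a; apply: V.
Qed.

(** * Fixed points of smoothed selections on the cube *)

Section Cube.
Variables (R : realType) (I : finType).
Implicit Types (x y z : I -> R) (e d : R).

Definition in_cube x := forall a, 0 <= x a <= 1.

Lemma natr_inv_small (e : R) : 0 < e -> exists k : nat, k.+1%:R^-1 <= e.
Proof.
move=> e0; exists (Num.bound e^-1).
rewrite invf_ple ?posrE ?ltr0n //.
apply: ltW; apply: lt_le_trans (archi_boundP _) _; first by rewrite invr_ge0 ltW.
by rewrite ler_nat.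
Qed.

(** An approximate Poincaré-Miranda theorem: each component of [G] takes both weak signs in one
    common small cell, hence is small there by uniform continuity. *)
Lemma cube_miranda (G : (I -> R) -> I -> R) :
  (forall e, 0 < e -> exists2 d, 0 < d & forall x y, in_cube x -> in_cube y ->
     (forall a, `|x a - y a| <= d) -> forall j, `|G x j - G y j| <= e) ->
  (forall x j, in_cube x -> x j = 0 -> 0 <= G x j) ->
  (forall x j, in_cube x -> x j = 1 -> G x j <= 0) ->
  forall e, 0 < e -> exists2 x, in_cube x & forall j, `|G x j| <= e.
Proof.
move=> Gc G0 G1 e e0; have [d d0 dG] := Gc e e0.
have [k kd] := natr_inv_small d0.
have k0 : 0 < k.+1%:R :> R by rewrite ltr0n.
pose pt (x : 'I_#|I| -> nat) : I -> R := fun a => (x (enum_rank a))%:R / k.+1%:R.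
have pt_cube (x : 'I_#|I| -> nat) : (forall a, (x a <= k.+1)%N) -> in_cube (pt x).
  move=> xk a; rewrite /pt divr_ge0 ?ler0n //= ler_pdivrMr // mul1r ler_nat; exact: xk.
(* The label records [G < 0], overridden on the two opposite faces to suit [grid_miranda]; there the
   boundary signs of [G] make up for the override. *)
pose l i (x : 'I_#|I| -> nat) := (x i == k.+1) || ((x i != 0%N) && (G (pt x) (enum_val i) < 0)).
have [|i x xi|p pk pl] := @grid_miranda #|I| k l.
- by move=> i x xi; rewrite /l xi eqxx.
- by rewrite /l xi eqxx.
have near (x : 'I_#|I| -> nat) : (forall a, (p a <= x a <= (p a).+1)%N) ->
    (forall a, (x a <= k.+1)%N) /\ forall j, `|G (pt p) j - G (pt x) j| <= e.
  move=> px; have xk a : (x a <= k.+1)%N by have := px a; have := pk a; lia.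
  split=> //; apply: dG; [|exact: pt_cube|] => [|a].
    by apply: pt_cube => a; have := pk a; lia.
  rewrite /pt -mulrBl normrM normfV (gtr0_norm k0).
  apply: le_trans kd; rewrite ler_piMl ?invr_ge0 ?(ltW k0) // distrC.
  have := px (enum_rank a); set q := p _; set q' := x _ => qq.
  have -> : q' = (q + (q' - q))%N by lia.
  by rewrite natrD [X in X - _]addrC addrK normr_nat (ler_nat R _ 1); lia.
exists (pt p) => [|j]; first by apply: pt_cube => a; have := pk a; lia.
have [x [y [px py lx ly]]] := pl (enum_rank j).
have [xk /(_ j)] := near x px; have [yk /(_ j)] := near y py.
have Gx : G (pt x) j <= 0.
  move: lx; rewrite /l enum_rankK => /orP[/eqP xj|/andP[_ /ltW//]].
  by apply: G1; [exact: pt_cube|rewrite /pt xj divff // gt_eqF].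
have Gy : 0 <= G (pt y) j.
  move: ly; rewrite /l enum_rankK negb_or => /andP[_]; rewrite negb_and negbK -leNgt.
  move=> /orP[/eqP yj|//].
  by apply: G0; [exact: pt_cube|rewrite /pt yj mul0r].
by rewrite !ler_norml; lra.
Qed.

Lemma cube_net (d : R) : 0 < d -> exists (T : finType) (y : T -> I -> R),
  (forall t, in_cube (y t)) /\
  forall x, in_cube x -> exists t, \sum_a `|x a - y t a| <= d.
Proof.
(* The sum over coordinates multiplies the mesh by [#|I|]; the successor keeps the divisor
   nonzero. *)
move=> d0; have [k kd] : exists k : nat, k.+1%:R^-1 <= d / #|I|.+1%:R.
  by apply: natr_inv_small; rewrite divr_gt0 ?ltr0n.
have k0 : 0 < k.+1%:R :> R by rewrite ltr0n.
exists {ffun I -> 'I_k.+2}, (fun (t : {ffun I -> 'I_k.+2}) a => (t a)%:R / k.+1%:R); split.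
  by move=> t a; rewrite divr_ge0 ?ler0n //= ler_pdivrMr // mul1r ler_nat -ltnS ltn_ord.
move=> x xc; exists [ffun a => inord (Num.truncn (x a * k.+1%:R))].
have xk a : `|x a - ([ffun a => inord (Num.truncn (x a * k.+1%:R))] a : 'I_k.+2)%:R / k.+1%:R|
    <= k.+1%:R^-1.
  have /andP[x0 x1] := xc a.
  have xk0 : 0 <= x a * k.+1%:R by rewrite mulr_ge0 // ltW.
  have /andP[t1 t2] := truncn_itv xk0.
  rewrite ffunE inordK; last first.
    rewrite ltnS -(ler_nat R); apply: le_trans t1 _.
    by rewrite ler_piMl // ltW.
  rewrite -{1}[x a](mulfK (lt0r_neq0 k0)) -mulrBl normrM normfV (gtr0_norm k0).
  rewrite ler_piMl ?invr_ge0 ?(ltW k0) // ler_norml.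
  by move: t1 t2; rewrite -natr1; lra.
apply: (@le_trans _ _ (\sum_(a : I) k.+1%:R^-1)).
  by apply: ler_sum => a _; exact: xk.
rewrite sumr_const cardT -cardE -[_ *+ _]mulr_natr.
apply: (@le_trans _ _ (d / #|I|.+1%:R * #|I|%:R)); first by rewrite ler_wpM2r.
rewrite mulrAC ler_pdivrMr ?ltr0n // ler_wpM2l ?(ltW d0) // ler_nat.
by rewrite leqW.
Qed.

Lemma approx_selection_fixpoint (b : (I -> R) -> I -> R) (d : R) :
  (forall x, in_cube x -> in_cube (b x)) -> 0 < d ->
  exists2 x, in_cube x & exists (T : finType) (y : T -> I -> R) (w : T -> R),
    [/\ forall t, in_cube (y t), is_dist w,
        forall t a, 0 < w t -> `|y t a - x a| <= d &
        forall a, `|x a - \sum_t w t * b (y t) a| <= d].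
Proof.
move=> bc d0; have d20 : 0 < d / 2 by lra.
have [T [y [yc ynet]]] := cube_net d20.
(* Tent functions of radius [d] over a net of mesh [d / 2]: at each point of the cube some [f t] is
   at least [d / 2], which bounds the normalising sum [F] from below. *)
pose f t x := Num.max 0 (d - \sum_a `|x a - y t a|).
have f0 t x : 0 <= f t x by rewrite /f le_max lexx.
have fd t x : f t x <= d.
  by rewrite /f ge_max (ltW d0) /= lerBlDr lerDl sumr_ge0.
have fL t x x' : `|f t x - f t x'| <= \sum_a `|x a - x' a|.
  have h u v : \sum_a `|u a - y t a| <= \sum_a `|u a - v a| + \sum_a `|v a - y t a|.
    rewrite -big_split; apply: ler_sum => a _ /=.
    exact: ler_distD.
  have h1 := h x x'; have h2 := h x' x; move: h1 h2.
  rewrite (eq_bigr (fun a => `|x a - x' a|) (fun a _ => distrC (x' a) (x a))).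
  rewrite /f ler_norml.
  set p := \sum_a _; set q := \sum_a _; set r := \sum_a _.
  have : 0 <= q by exact: sumr_ge0.
  by rewrite !maxEle; case: ifP; case: ifP; lra.
pose G x j := \sum_t f t x * (b (y t) j - x j).
have bx1 t x j : in_cube x -> `|b (y t) j - x j| <= 1.
  by move=> /(_ j); have := bc _ (yc t) j; rewrite ler_norml; lra.
(* [C - 1] is a Lipschitz constant of [G] for the maximum norm: [f t] varies by at most [#|I|] times
   the displacement and is itself at most [d]. *)
pose C : R := #|T|%:R * (#|I|%:R + d) + 1.
have C0 : 0 < C.
  by rewrite /C ltr_wpDl // mulr_ge0 // addr_ge0 // ltW.
(* Dividing by [F >= d / 2] will turn the tolerance [d * (d / 2)] into [d]. *)
have [||||x xc Gx] := @cube_miranda G _ _ _ (d * (d / 2)) _.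
- move=> e e0; exists (e / C) => [|x x' xc xc' xx' j]; first exact: divr_gt0.
  have eC : 0 <= e / C by rewrite divr_ge0 // ltW.
  have step t : `|f t x * (b (y t) j - x j) - f t x' * (b (y t) j - x' j)|
      <= e / C * (#|I|%:R + d).
    have -> : f t x * (b (y t) j - x j) - f t x' * (b (y t) j - x' j) =
      (f t x - f t x') * (b (y t) j - x j) + f t x' * (x' j - x j) by lra.
    apply: le_trans (ler_normD _ _) _; rewrite !normrM mulrDr lerD //.
      apply: le_trans (ler_pM _ _ (fL t x x') (bx1 t x j xc)) _ => //.
      rewrite mulr1; apply: (@le_trans _ _ (\sum_(a : I) e / C)); first exact: ler_sum.
      by rewrite sumr_const cardT -cardE -[_ *+ _]mulr_natr.
    rewrite (ger0_norm (f0 _ _)) mulrC ler_pM // distrC; exact: xx'.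
  rewrite /G -sumrB; apply: le_trans (ler_norm_sum _ _ _) _.
  apply: (@le_trans _ _ (\sum_(t : T) (e / C * (#|I|%:R + d)))); first exact: ler_sum.
  have hC : #|T|%:R * (#|I|%:R + d) = C - 1 by rewrite /C addrK.
  rewrite sumr_const cardT -cardE -[_ *+ _]mulr_natr -mulrA [_ * #|T|%:R]mulrC hC.
  by rewrite -[leRHS]mulr1 -mulrA ler_pM2l // mulrC ler_pdivrMr //; lra.
- move=> x j xc xj; apply: sumr_ge0 => t _; rewrite mulr_ge0 // xj subr0.
  by have /andP[] := bc _ (yc t) j.
- move=> x j xc xj; rewrite -oppr_ge0 -sumrN; apply: sumr_ge0 => t _.
  rewrite -mulrN mulr_ge0 // xj oppr_ge0 subr_le0.
  by have /andP[] := bc _ (yc t) j.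
- by rewrite mulr_gt0.
exists x => //; pose F := \sum_t f t x.
have Fd : d / 2 <= F.
  have [t xt] := ynet x xc; rewrite /F (bigD1 t) //=.
  have : d / 2 <= f t x by rewrite /f le_max; apply/orP; right; lra.
  have : 0 <= \sum_(i | i != t) f i x by apply: sumr_ge0.
  by lra.
have F0 : 0 < F by apply: lt_le_trans Fd.
exists T, y, (fun t => f t x / F); split => //.
- split => [t|]; first by rewrite divr_ge0 // ltW.
  by rewrite -mulr_suml divff // gt_eqF.
- move=> t a; rewrite pmulr_lgt0 ?invr_gt0 // /f lt_max ltxx /= subr_gt0 => /ltW h.
  apply: le_trans h; rewrite (bigD1 a) //= distrC lerDl; exact: sumr_ge0.
- move=> a; have := Gx a.
  have -> : G x a = F * (\sum_t f t x / F * b (y t) a - x a).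
    rewrite /G mulrBr mulr_sumr mulr_suml -sumrB; apply: eq_bigr => t _.
    by rewrite mulrA [F * _]mulrCA divff ?gt_eqF // mulr1 mulrBr.
  rewrite normrM (gtr0_norm F0) distrC => h.
  rewrite -(ler_pM2l F0); apply: le_trans h _.
  by rewrite mulrC ler_wpM2r // ltW.
Qed.

Lemma increasing_ge_id (s : nat -> nat) : increasing_seq s -> forall k, (k <= s k)%N.
Proof.
move=> incs; elim=> // k IH; apply: leq_ltn_trans IH _.
have : (s k < s k.+1)%O by rewrite ltNge incs ltnn.
by [].
Qed.

Lemma cvg_subseq (s : nat -> nat) (u : nat -> R) (l : R) : (forall k, (k <= s k)%N) ->
  u k @[k --> \oo] --> l -> u (s k) @[k --> \oo] --> l.
Proof.
move=> sk ul; apply: (@cvg_comp _ _ _ s u _ \oo) => //.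
apply/cvgnyPge => M; near=> k; apply: leq_trans (sk k).
by near: k; exact: nbhs_infty_ge.
Unshelve. all: by end_near. Qed.

Lemma cube_cvg_subseq (u : nat -> I -> R) : (forall k, in_cube (u k)) ->
  exists (s : nat -> nat) (z : I -> R), [/\ forall k, (k <= s k)%N, in_cube z &
    forall a, u (s k) a @[k --> \oo] --> z a].
Proof.
move=> uc.
have [s [incs /(_ _ (mem_enum _ _)) cvs]] : exists s : nat -> nat, increasing_seq s /\
    forall a, a \in enum I -> cvgn (fun k => u (s k) a).
  elim: (enum I) => [|a r [s [incs cvs]]]; first by exists id.
  have [|s' incs' cvs'] := @bolzano_weierstrass _ (fun k => u (s k) a).
    exists 1; split => // M M1 k _ /=.
    have /andP[u0 u1] := uc (s k) a.
    by rewrite ger0_norm //; apply: le_trans u1 _; apply: ltW.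
  exists (s \o s'); split => [i j|c] /=; first by rewrite incs -leEnat incs'.
  rewrite inE => /predU1P[->//|/cvs /cvg_ex[l cl]].
  apply/cvg_ex; exists l; exact: cvg_subseq (increasing_ge_id incs') cl.
exists s, (fun a => limn (fun k => u (s k) a)); split => [||a].
- exact: increasing_ge_id.
- move=> a; apply/andP; split.
    by apply: limr_ge => //; apply: nearW => k; have /andP[] := uc (s k) a.
  by apply: limr_le => //; apply: nearW => k; have /andP[] := uc (s k) a.
- exact: cvs.
Qed.

(** The point [z] is a cluster point of approximate fixed points. As [b] may be discontinuous, no
    limit of its values is taken: the averages found near [z] are kept as they are. *)
Lemma selection_fixpoint (b : (I -> R) -> I -> R) :
  (forall x, in_cube x -> in_cube (b x)) ->
  exists2 z, in_cube z & forall e, 0 < e ->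
    exists (T : finType) (y : T -> I -> R) (w : T -> R),
    [/\ forall t, in_cube (y t), is_dist w,
        forall t a, 0 < w t -> `|y t a - z a| <= e &
        forall a, `|z a - \sum_t w t * b (y t) a| <= e].
Proof.
move=> bc.
have /choice[u hu] n : exists x, in_cube x /\ exists (T : finType) (y : T -> I -> R) (w : T -> R),
    [/\ forall t, in_cube (y t), is_dist w,
        forall t a, 0 < w t -> `|y t a - x a| <= n.+1%:R^-1 &
        forall a, `|x a - \sum_t w t * b (y t) a| <= n.+1%:R^-1].
  have [|x xc h] := approx_selection_fixpoint bc (d := n.+1%:R^-1); last by exists x.
  by rewrite invr_gt0 ltr0n.
have [s [z [sk zc cz]]] := cube_cvg_subseq (fun k => (hu k).1).
exists z => // e e0; have e20 : 0 < e / 2 by lra.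
have [K Ke] := natr_inv_small e20.
have [k [Kk uz]] : exists k, (K <= k)%N /\ forall a, `|z a - u (s k) a| <= e / 2.
  have : \forall k \near \oo, (K <= k)%N /\ forall a, `|z a - u (s k) a| <= e / 2.
    near=> k; split; first by near: k; exact: nbhs_infty_ge.
    near: k; apply: filter_forall => a.
    by have /cvgrPdist_le/(_ _ e20) := cz a.
  by move=> /filter_ex.
have [_ [T [y [w [yc wd wy wb]]]]] := hu (s k).
have ske : (s k).+1%:R^-1 <= e / 2.
  apply: le_trans Ke; rewrite lef_pV2 ?posrE ?ltr0n // ler_nat ltnS.
  exact: leq_trans Kk (sk k).
exists T, y, w; split => // [t a wt|a].
  by have := le_trans (wy t a wt) ske; have := uz a; rewrite !ler_norml; lra.
by have := le_trans (wb a) ske; have := uz a; rewrite !ler_norml; lra.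
Unshelve. all: by end_near. Qed.

End Cube.

(** * Distributions *)

Section Dist.
Variables (R : realType) (T : finType).
Implicit Types p q : T -> R.

Lemma is_dist_in_cube p : is_dist p -> in_cube p.
Proof.
move=> [p0 p1] t; rewrite p0 -p1 (bigD1 t) //= lerDl; exact: sumr_ge0.
Qed.

Lemma is_dist_sum p (Q : pred T) : is_dist p -> 0 <= \sum_(t | Q t) p t <= 1.
Proof.
move=> [p0 <-]; rewrite sumr_ge0 //= [leRHS](bigID Q) /= lerDl; exact: sumr_ge0.
Qed.

Lemma is_dist_pred1 (t0 : T) : is_dist (fun t => (t == t0)%:R : R).
Proof.
split=> [t|]; first exact: ler0n.
by rewrite (bigD1 t0) //= eqxx big1 ?addr0 // => t /negPf ->.
Qed.

Lemma cvg_sum_fin (P : pred T) (u : nat -> T -> R) (l : T -> R) :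
  (forall t, u k t @[k --> \oo] --> l t) ->
  \sum_(t | P t) u k t @[k --> \oo] --> \sum_(t | P t) l t.
Proof.
by move=> ul; apply: cvg_big => [|t _]; [exact: add_continuous|exact: ul].
Qed.

Lemma cvg_prod_fin (P : pred T) (u : nat -> T -> R) (l : T -> R) :
  (forall t, u k t @[k --> \oo] --> l t) ->
  \prod_(t | P t) u k t @[k --> \oo] --> \prod_(t | P t) l t.
Proof.
by move=> ul; apply: cvg_big => [|t _]; [exact: mul_continuous|exact: ul].
Qed.

Lemma is_dist_lim (u : nat -> T -> R) p : (forall k, is_dist (u k)) ->
  (forall t, u k t @[k --> \oo] --> p t) -> is_dist p.
Proof.
move=> ud up; split=> [t|].
  rewrite -(cvg_lim _ (up t)) //; apply: limr_ge; first by apply/cvg_ex; exists (p t).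
  by apply: nearW => k; have [] := ud k.
have := cvg_sum_fin (P := predT) up; rewrite (_ : (fun _ => _) = fun=> 1) => [h|].
  by rewrite -(cvg_lim _ h) // lim_cst.
by apply/funext => k; have [] := ud k.
Qed.

Lemma is_dist_convex : convex_set (fun p => is_dist p).
Proof.
move=> p q t [p0 p1] [q0 q1] /andP[t0 t1]; split=> [a|].
  by rewrite addr_ge0 // mulr_ge0 // subr_ge0.
by rewrite big_split -!mulr_sumr /= p1 q1 !mulr1 addrC subrK.
Qed.

Lemma is_dist_closed : closed_set (fun p => is_dist p).
Proof.
move=> p hp.
have /choice[u hu] k : exists q, is_dist q /\ forall a, `|p a - q a| < k.+1%:R^-1.
  by have [|q qd pq] := hp k.+1%:R^-1; [rewrite invr_gt0 ltr0n|exists q].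
apply: (@is_dist_lim u) => [k|t]; first by have [] := hu k.
apply/cvgrPdist_le => e e0; have [K Ke] := natr_inv_small e0.
near=> k; apply: le_trans Ke; apply: ltW; apply: lt_le_trans ((hu k).2 t) _.
rewrite lef_pV2 ?posrE ?ltr0n // ler_nat ltnS.
by near: k; exact: nbhs_infty_ge.
Unshelve. all: by end_near. Qed.

Lemma convex_set_sum (C : set (T -> R)) (S : finType) (w : S -> R) (c : S -> T -> R) :
  convex_set C -> is_dist w -> (forall s, 0 < w s -> C (c s)) ->
  C (fun a => \sum_s w s * c s a).
Proof.
move=> cC [w0 w1] wc.
(* Convexity is binary, so the sum grows along a list with normalised partial sums; zero weights are
   treated apart, since [c s] need not lie in [C] there. *)
suff H (r : seq S) : 0 < \sum_(s <- r) w s ->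
    C (fun a => (\sum_(s <- r) w s * c s a) / \sum_(s <- r) w s).
  have := H (index_enum S); rewrite w1 => /(_ ltr01).
  by congr C; apply/funext => a; rewrite divr1.
elim: r => [|s r IH]; first by rewrite big_nil ltxx.
have W0 : 0 <= \sum_(j <- r) w j by exact: sumr_ge0.
have [ws0|ws0] := eqVneq (w s) 0.
  rewrite big_cons ws0 add0r => /IH; congr C; apply/funext => a.
  by rewrite !big_cons ws0 mul0r !add0r.
have {}ws0 : 0 < w s by rewrite lt0r ws0 w0.
move=> _; move: W0; rewrite le_eqVlt => /predU1P[W0|W0].
  have /allP wr : all (fun j => true ==> (w j == 0)) r by rewrite -psumr_eq0 // -W0.
  have := wc s ws0; congr C; apply/funext => a; rewrite !big_cons -W0 addr0.
  rewrite [X in _ + X]big1_seq ?addr0 => [|j /andP[_ /wr /eqP ->]]; last by rewrite mul0r.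
  by rewrite mulrC mulKf // gt_eqF.
have := cC _ _ (w s / (w s + \sum_(j <- r) w j)) (wc s ws0) (IH W0).
set W := \sum_(j <- r) w j in W0 *.
have sW : 0 < w s + W by rewrite addr_gt0.
have le1 : 0 <= w s / (w s + W) <= 1.
  by rewrite divr_ge0 ?(ltW ws0) ?(ltW sW) //= ler_pdivrMr // mul1r lerDl ltW.
move=> /(_ le1); congr C; apply/funext => a; rewrite !big_cons -/W.
set X := \sum_(j <- r) _.
have -> : 1 - w s / (w s + W) = W / (w s + W).
  by rewrite -{1}(divff (lt0r_neq0 sW)) -mulrBl addrC addKr.
rewrite mulrDl mulrAC; congr (_ + _).
by rewrite mulrCA [W / _ / _]mulrAC divff ?mul1r // gt_eqF.
Qed.

End Dist.

(** * Best responses *)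

(** The weighting functions are continuous only relative to the unit interval, so the sequence and
    its limit must stay in it. *)
Lemma cvg_unit_itv (R : realType) (w : R -> R) (s : nat -> R) (l : R) :
  {within `[0, 1], continuous w} -> (forall k, 0 <= s k <= 1) -> 0 <= l <= 1 ->
  s k @[k --> \oo] --> l -> w (s k) @[k --> \oo] --> w l.
Proof.
move=> /subspace_continuousP wc s01 l01 sl.
have lA : `[0, 1]%classic l by rewrite /= in_itv.
move=> Q wQ.
have H : \forall k \near \oo, `[0, 1]%classic (s k) -> Q (w (s k)) := sl _ (wc l lA Q wQ).
suff : \forall k \near \oo, Q (w (s k)) by [].
by near=> k; apply: (near H k); [|rewrite /= in_itv /= s01].
Unshelve. all: by end_near. Qed.

Lemma cpt_value_cvg (R : realType) (P : cpt R) (T : finType) (x : T -> R)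
    (u : nat -> T -> R) (p : T -> R) :
  (forall k, is_dist (u k)) -> (forall t, u k t @[k --> \oo] --> p t) ->
  cpt_value P [seq (u k t, x t) | t <- enum T] @[k --> \oo] -->
  cpt_value P [seq (p t, x t) | t <- enum T].
Proof.
move=> ud up; have pd := is_dist_lim ud up.
have sumE (q : T -> R) (Q : pred R) :
    \sum_(pr <- [seq (q t, x t) | t <- enum T] | Q pr.2) pr.1 = \sum_(t | Q (x t)) q t.
  by rewrite big_map big_enum_cond.
have wcvg (w : R -> R) (Q : pred R) : {within `[0, 1], continuous w} ->
    w (\sum_(pr <- [seq (u k t, x t) | t <- enum T] | Q pr.2) pr.1) @[k --> \oo] -->
    w (\sum_(pr <- [seq (p t, x t) | t <- enum T] | Q pr.2) pr.1).
  move=> wc; apply: cvg_unit_itv => // [k||].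
  - by rewrite sumE; exact: is_dist_sum.
  - by rewrite sumE; exact: is_dist_sum.
  - under eq_cvg do rewrite sumE.
    by rewrite sumE; exact: cvg_sum_fin.
have outE (q : T -> R) :
    [seq pr.2 | pr <- [seq (q t, x t) | t <- enum T]] = map x (enum T).
  by rewrite -map_comp.
rewrite /cpt_value outE; under eq_cvg do rewrite outE.
apply: cvg_big => [|y _]; first exact: add_continuous.
case: ifP => _.
  apply: cvgM; first exact: cvg_cst.
  apply: cvgB.
    by apply: (wcvg _ (fun z => y <= z)); exact: cpt_wp_cont.
  by apply: (wcvg _ (fun z => y < z)); exact: cpt_wp_cont.
case: ifP => _; last exact: cvg_cst.
apply: cvgM; first exact: cvg_cst.
apply: cvgB.
  by apply: (wcvg _ (fun z => z <= y)); exact: cpt_wm_cont.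
by apply: (wcvg _ (fun z => z < y)); exact: cpt_wm_cont.
Qed.

Lemma cpt_value_ub (R : realType) (P : cpt R) (T : finType) (x : T -> R) :
  exists M, forall p : T -> R, is_dist p -> cpt_value P [seq (p t, x t) | t <- enum T] <= M.
Proof.
exists (\sum_(y <- undup (map x (enum T))) `|cpt_v P y|) => p pd.
have sumE (Q : pred R) : 0 <=
    \sum_(pr <- [seq (p t, x t) | t <- enum T] | Q pr.2) pr.1 <= 1.
  by rewrite big_map big_enum_cond; exact: is_dist_sum.
have bound (w : R -> R) (Q1 Q2 : pred R) y : (forall s, 0 <= s <= 1 -> 0 <= w s <= 1) ->
    cpt_v P y * (w (\sum_(pr <- [seq (p t, x t) | t <- enum T] | Q1 pr.2) pr.1) -
       w (\sum_(pr <- [seq (p t, x t) | t <- enum T] | Q2 pr.2) pr.1)) <= `|cpt_v P y|.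
  move=> w01; apply: le_trans (ler_norm _) _; rewrite normrM ler_piMr //.
  by have := w01 _ (sumE Q1); have := w01 _ (sumE Q2); rewrite ler_norml; lra.
rewrite /cpt_value -map_comp; apply: ler_sum => y _.
case: ifP => _; first by apply: (bound _ (fun z => y <= z) (fun z => y < z)); exact: cpt_wp_range.
case: ifP => _ //.
by apply: (bound _ (fun z => z <= y) (fun z => z < y)); exact: cpt_wm_range.
Qed.

Section BestResponse.
Variables (R : realType) (n : nat) (A : 'I_n -> finType).
Implicit Types sigma : forall j, A j -> R.

Lemma sum_profile_prod sigma :
  \sum_(a : profile A) \prod_j sigma j (a j) = \prod_j \sum_(t : A j) sigma j t.
Proof.
pose Q j : {ffun A j -> R} := [ffun t => sigma j t].
rewrite (reindex (@dffun_of_fprod _ A)) /=; last exact/onW_bij/dffun_of_fprod_bij.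
transitivity (\sum_(t : fprod A) \prod_(j in 'I_n) Q j (t j)).
  by apply: eq_bigr => t _; apply: eq_bigr => j _; rewrite !ffunE.
rewrite big_fprod -(bigA_distr_big_dep (fun j => mem (tagged_with A j))
  (fun j u => untag 0 (Q j) u)) /=.
apply: eq_bigr => j _; rewrite -(big_tag (fun j => Q j) j).
by apply: eq_bigr => t _; rewrite ffunE.
Qed.

Lemma is_dist_joint i (b : A i -> R) sigma :
  is_dist b -> (forall j, is_dist (sigma j)) ->
  is_dist (fun a : profile A => joint_prob i b sigma a).
Proof.
move=> [b0 b1] sd; split=> [a|].
  by rewrite mulr_ge0 // prodr_ge0 // => j _; have [] := sd j.
(* Putting [b] in place of [sigma i] makes the joint probability a plain product of
   distributions. *)
transitivity (\sum_(a : profile A) \prod_j @dfwith _ _ sigma i b j (a j)).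
  apply: eq_bigr => a _; rewrite (bigD1 i) //= dfwithin; congr (_ * _).
  by apply: eq_bigr => j ji; rewrite dfwithout // eq_sym.
rewrite sum_profile_prod big1 // => j _.
have [->|ji] := eqVneq j i; first by rewrite dfwithin.
by rewrite dfwithout 1?eq_sym //; have [] := sd j.
Qed.

Lemma player_value_cvg (P : cpt R) (x : profile A -> R) i (b : nat -> A i -> R)
    (sigma : nat -> forall j, A j -> R) (b' : A i -> R) sigma' :
  (forall k, is_dist (b k)) -> (forall k j, is_dist (sigma k j)) ->
  (forall t, b k t @[k --> \oo] --> b' t) ->
  (forall j t, sigma k j t @[k --> \oo] --> sigma' j t) ->
  cpt_value P (player_lottery x i (b k) (sigma k)) @[k --> \oo] -->
  cpt_value P (player_lottery x i b' sigma').
Proof.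
move=> bd sd bb ss.
apply: (@cpt_value_cvg _ P _ x (fun k a => joint_prob i (b k) (sigma k) a)
  (fun a => joint_prob i b' sigma' a)) => [k|a].
  exact: is_dist_joint.
apply: cvgM; first exact: bb.
by apply: (@cvg_prod_fin _ _ _ (fun k j => sigma k j (a j))) => j; exact: ss.
Qed.

Lemma best_resp_nonempty (P : cpt R) (x : profile A -> R) i sigma :
  (0 < #|A i|)%N -> (forall j, is_dist (sigma j)) -> exists b, best_resp P x i sigma b.
Proof.
move=> /card_gt0P[a0 _] sd.
pose V b := cpt_value P (player_lottery x i b sigma).
have [M VM] := cpt_value_ub P x.
pose S := [set V b | b in [set b | is_dist b]].
have supS : has_sup S.
  split.
    by exists (V (fun t => (t == a0)%:R)), (fun t => (t == a0)%:R) => //; exact: is_dist_pred1.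
  by exists M => _ [b bd <-]; apply: VM; exact: is_dist_joint.
(* A maximising sequence, whose limit points attain the supremum by continuity of the value. *)
have /choice[b hb] k : exists b, is_dist b /\ sup S - k.+1%:R^-1 < V b.
  have [|_ [b bd <-] h] := @sup_adherent _ S k.+1%:R^-1 _ supS; last by exists b.
  by rewrite invr_gt0 ltr0n.
have [s [b' [sk _ cb]]] := cube_cvg_subseq (fun k => is_dist_in_cube (hb k).1).
have bd' : is_dist b' by apply: is_dist_lim cb => k; have [] := hb (s k).
exists b'; split => // c cd.
have Vc : V (b (s k)) @[k --> \oo] --> V b'.
  by apply: player_value_cvg => // [k|j t]; [have [] := hb (s k)|exact: cvg_cst].
apply: (@le_trans _ _ (sup S)).
  by apply: (sup_upper_bound supS); exists c.
rewrite -/(V b') -(cvg_lim _ Vc) //; apply/ler_addgt0Pr => e e0.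
rewrite -lerBlDr; apply: limr_ge; first by apply/cvg_ex; eexists; exact: Vc.
have [K Ke] := natr_inv_small e0.
near=> k; apply: le_trans (ltW (hb (s k)).2); rewrite lerD2l lerN2.
apply: le_trans Ke; rewrite lef_pV2 ?posrE ?ltr0n // ler_nat ltnS.
by apply: leq_trans (sk k); near: k; exact: nbhs_infty_ge.
Unshelve. all: by end_near. Qed.

Lemma best_resp_closed_graph (P : cpt R) (x : profile A -> R) i (b : nat -> A i -> R)
    (sigma : nat -> forall j, A j -> R) (b' : A i -> R) sigma' :
  (forall k j, is_dist (sigma k j)) ->
  (forall k, best_resp P x i (sigma k) (b k)) ->
  (forall t, b k t @[k --> \oo] --> b' t) ->
  (forall j t, sigma k j t @[k --> \oo] --> sigma' j t) ->
  best_resp P x i sigma' b'.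
Proof.
move=> sd bbr bb ss; have bd k : is_dist (b k) by have [] := bbr k.
split=> [|c cd]; first exact: is_dist_lim bb.
have Vb := player_value_cvg (P := P) (x := x) bd sd bb ss.
have Vc : cpt_value P (player_lottery x i c (sigma k)) @[k --> \oo] -->
    cpt_value P (player_lottery x i c sigma').
  by apply: player_value_cvg => // t; exact: cvg_cst.
rewrite -(cvg_lim _ Vb) // -(cvg_lim _ Vc) //; apply: ler_lim.
- by apply/cvg_ex; eexists; exact: Vc.
- by apply/cvg_ex; eexists; exact: Vb.
- by apply: nearW => k; have [_] := bbr k; apply.
Qed.

(** * The retraction of the cube onto the product of simplices *)

Notation I := {i : 'I_n & A i}.

(** Missing mass is spread evenly and excess mass is divided out. The denominator is at least 1,
    which keeps the map continuous. *)
Definition retract (z : I -> R) (i : 'I_n) (a : A i) : R :=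
  let s := \sum_(t : A i) z (Tagged A t) in
  (z (Tagged A a) + Num.max 0 (1 - s) / #|A i|%:R) / Num.max 1 s.

Lemma retract_dist z i : (0 < #|A i|)%N -> in_cube z -> is_dist (@retract z i).
Proof.
move=> Ai zc; rewrite /retract; set s := \sum_t _.
have m1 : 0 < Num.max 1 s by rewrite lt_max ltr01.
split=> [a|].
  rewrite divr_ge0 ?(ltW m1) // addr_ge0 //; first by have /andP[] := zc (Tagged A a).
  by rewrite divr_ge0 // le_max lexx.
rewrite -mulr_suml big_split /= sumr_const cardT -cardE -[_ *+ _]mulr_natr divfK; last first.
  by rewrite pnatr_eq0 -lt0n.
apply: (canLR (mulfK (lt0r_neq0 m1))); rewrite mul1r -/s.
by rewrite !maxEle; case: ifP; case: ifP; lra.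
Qed.

Lemma retract_id z i : is_dist (fun a : A i => z (Tagged A a)) ->
  @retract z i = fun a => z (Tagged A a).
Proof.
move=> [_ z1]; apply/funext => a.
by rewrite /retract z1 subrr maxxx mul0r addr0 maxxx divr1.
Qed.

Lemma retract_cvg (y : nat -> I -> R) z i a : (forall t, y k t @[k --> \oo] --> z t) ->
  @retract (y k) i a @[k --> \oo] --> @retract z i a.
Proof.
move=> yz; rewrite /retract.
have sc := cvg_sum_fin (P := predT) (fun t : A i => yz (Tagged A t)).
have maxc (c d : R) (f : nat -> R) : f k @[k --> \oo] --> d ->
    Num.max c (f k) @[k --> \oo] --> Num.max c d.
  move=> fd; rewrite maxr_absE; under eq_cvg do rewrite maxr_absE.
  apply: cvgM; last exact: cvg_cst.
  apply: cvgD; first by apply: cvgD => //; exact: cvg_cst.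
  by apply: cvg_norm; apply: cvgB => //; exact: cvg_cst.
apply: cvgM.
  apply: cvgD => //; apply: cvgM; last exact: cvg_cst.
  apply: maxc; apply: cvgB => //; exact: cvg_cst.
by apply: cvgV; [rewrite gt_eqF // lt_max ltr01|exact: maxc].
Qed.

End BestResponse.

(** * Upper hemicontinuity and the equilibrium *)

Section Equilibrium.
Variables (R : realType) (n : nat) (A : 'I_n -> finType).
Hypothesis A_gt0 : forall i, (0 < #|A i|)%N.
Variables (x : forall i : 'I_n, profile A -> R) (P : 'I_n -> cpt R).

Notation I := {i : 'I_n & A i}.
Notation BR z i := (best_resp (P i) (x i) i (@retract _ _ _ z)).

(** Failure for every [d] of the form [k.+1%:R^-1] would give best responses staying away from those
    at [z], but by the closed graph a convergent subsequence has its limit among them. *)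
Lemma best_resp_uhc i (z : I -> R) : in_cube z -> forall e, 0 < e ->
  exists2 d, 0 < d & forall y b, in_cube y -> (forall t, `|y t - z t| <= d) ->
    BR y i b -> exists2 c, BR z i c & forall a, `|b a - c a| <= e.
Proof.
move=> zc e e0; apply: contrapT => N.
have /choice[yb h] k : exists yb : (I -> R) * (A i -> R),
    [/\ in_cube yb.1, forall t, `|yb.1 t - z t| <= k.+1%:R^-1, BR yb.1 i yb.2 &
      forall c, BR z i c -> ~ forall a, `|yb.2 a - c a| <= e].
  apply: contrapT => M; apply: N; exists k.+1%:R^-1; first by rewrite invr_gt0 ltr0n.
  move=> y b yc yz bb; apply: contrapT => K; apply: M; exists (y, b); split=> // c cb ce.
  by apply: K; exists c.
have bc k : in_cube (yb k).2 by apply: is_dist_in_cube; case: (h k) => _ _ [].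
have [s [c [sk _ cc]]] := cube_cvg_subseq bc.
have yz t : (yb (s k)).1 t @[k --> \oo] --> z t.
  apply/cvgrPdist_le => e' e'0; have [K Ke] := natr_inv_small e'0.
  near=> k; rewrite distrC; have [_ yz _ _] := h (s k).
  apply: le_trans (yz t) (le_trans _ Ke).
  rewrite lef_pV2 ?posrE ?ltr0n // ler_nat ltnS.
  by apply: leq_trans (sk k); near: k; exact: nbhs_infty_ge.
have cBR : BR z i c.
  apply: (best_resp_closed_graph (b := fun k => (yb (s k)).2)
    (sigma := fun k => @retract _ _ _ (yb (s k)).1)) => // [k j|k|j t].
  - by apply: retract_dist => //; case: (h (s k)).
  - by case: (h (s k)).
  - exact: (retract_cvg (y := fun k => (yb (s k)).1)).
have [k ck] : exists k, forall a, `|(yb (s k)).2 a - c a| <= e.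
  have : \forall k \near \oo, forall a, `|(yb (s k)).2 a - c a| <= e.
    near=> k; move=> a; rewrite distrC; move: a; near: k; apply: filter_forall => a.
    by have /cvgrPdist_le/(_ _ e0) := cc a.
  by move=> /filter_ex.
by have [_ _ _ /(_ c cBR)] := h (s k); apply.
Unshelve. all: by end_near. Qed.

Lemma equilibrium_in_cube : exists2 z : I -> R, in_cube z &
  forall i C, convex_set C -> closed_set C -> BR z i `<=` C ->
    C (fun a => z (Tagged A a)).
Proof.
have BRne (y : I -> R) i : in_cube y -> exists b, BR y i b.
  by move=> yc; apply: best_resp_nonempty => // j; exact: retract_dist.
(* An arbitrary choice of best responses, with the filler 0 outside the cube. *)
pose B y i : A i -> R :=
  if pselect (in_cube y) is left yc then sval (cid (BRne y i yc)) else fun=> 0.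
have B_BR y i : in_cube y -> BR y i (B y i).
  by move=> yc; rewrite /B; case: pselect => // yc'; exact: svalP.
have [|z zc hz] := @selection_fixpoint R I (fun y t => B y (tag t) (tagged t)).
  move=> y yc [i a] /=; apply: is_dist_in_cube; by have [] := B_BR y i yc.
exists z => // i C Cc Ccl BC; apply: Ccl => e e0.
have e40 : 0 < e / 4 by lra.
have [d d0 hd] := best_resp_uhc i zc e40.
(* Within [d], best responses are [e / 4] close to those at [z]; the averaging error is another
   [e / 4], and the total stays strictly below [e]. *)
have [|T [y [w [yc wd wy wb]]]] := hz (Num.min d (e / 4)).
  by rewrite lt_min d0.
have /choice[c hc] t : exists c, 0 < w t ->
    BR z i c /\ forall a, `|B (y t) i a - c a| <= e / 4.
  have [wt|_] := boolP (0 < w t); last by exists (fun=> 0).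
  have [|c cb ce] := hd (y t) (B (y t) i) (yc t) _ (B_BR _ _ (yc t)); last by exists c.
  by move=> u; have := wy t u wt; rewrite le_min => /andP[].
exists (fun a => \sum_t w t * c t a).
  by apply: convex_set_sum => // t /hc[/BC].
move=> a; have := wb (Tagged A a); rewrite le_min => /andP[_] /=.
set S := \sum_t _; set S' := \sum_t _ => zS.
have SS' : `|S - S'| <= e / 4.
  rewrite /S /S' -sumrB; apply: le_trans (ler_norm_sum _ _ _) _.
  have [w0 w1] := wd.
  have <- : \sum_t w t * (e / 4) = e / 4 by rewrite -mulr_suml w1 mul1r.
  apply: ler_sum => t _.
  rewrite -mulrBr normrM (ger0_norm (w0 t)).
  have := w0 t; rewrite le_eqVlt => /predU1P[<-|wt]; first by rewrite !mul0r.
  by rewrite ler_pM2l //; have [_] := hc t wt; apply.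
by move: zS SS'; rewrite !ler_norml ltr_norml; lra.
Qed.

End Equilibrium.

Theorem theorem2 (R : realType) (n : nat) (A : 'I_n -> finType)
  (hA : forall i, (0 < #|A i|)%N)
  (x : forall i : 'I_n, profile A -> R) (P : 'I_n -> cpt R) :
  exists sigma : forall i : 'I_n, A i -> R,
    (forall i, is_dist (sigma i)) /\
    (forall i, cl_co (best_resp (P i) (x i) i sigma) (sigma i)).
Proof.
have [z zc hz] := equilibrium_in_cube hA x P.
(* With the set of distributions as [C], the point [z] turns out to be a profile of mixed
   strategies, so [retract] fixes it and disappears from the best responses. *)
have zd i : is_dist (fun a : A i => z (Tagged A a)).
  apply: (hz i (fun p => is_dist p)); [exact: is_dist_convex|exact: is_dist_closed|].
  by move=> b [].
have rE : @retract R n A z = fun i a => z (Tagged A a).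
  by apply: functional_extensionality_dep => i; exact: retract_id.
exists (fun i a => z (Tagged A a)); split=> // i C Cc Ccl BC.
by apply: hz => //; rewrite rE.
Qed.
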